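(* Let $A \subset \mathbb{R}$ be finite. Then $$|A(A-A)| \gtrsim |A|^{\frac{3}{2}+\frac{1}{34}}.$$
   Context: $A-A=\{a-b: a,b\in A\}$ and $A(A-A)=\{a(b-c): a,b,c\in A\}$. Notation: $X \ll Y$ (equivalently $Y\gg X$) means $X\le cY$ for an absolute constant $c>0$. $X \gtrsim Y$ means there is an absolute constant $c>0$ such that $X \gg Y/(\log X)^c$. Logarithms are base 2. *)

(* Defs.v *)
From Stdlib Require Import Reals.
From mathcomp Require Import all_boot.
From mathcomp Require Import Rstruct.

Open Scope R_scope.

Definition log2 (x : R) : R := ln x / ln 2.

Definition prod_diff_set (A : seq R) : seq R :=
  undup (flatten [seq [seq a * (bc.1 - bc.2) | bc <- [seq (b, c) | b <- A, c <- A]] | a <- A]).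

(* Main.v *)
(* Lines meeting a Cartesian grid are cut into few pieces by a partition of the
   grid into rectangular blocks, because a line crosses the blocks
   monotonically; since two points determine a line, this gives the
   Szemeredi-Trotter bound for grids, with a free block parameter [rho].

   Let [n = |A|], [X = |A(A-A)|] and [0 \notin A].  By Cauchy-Schwarz the equation
   [a(b-c) = a'(b'-c')] has at least [n^6 / X] solutions; sorting them by the
   ratio [a/a'] and bounding incidences with the grid [A x A] produces a set [P]
   of ratios, each with at least [k] representations, such that
   [|P| k^2 >~ n^6 / X^2].  Hence there is [B] inside [A], every element of
   which has at least [m] representations as a product in [P * A], where
   [m |B| >~ |P| k].  Writing [b - c = p q - c], the grid bound again controls the
   third moments of the representation functions of [B - C] for every [C].  With
   [D = B - B], the Schoen-Shkredov argument (the map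
   [(b1, b2, b3) |-> (b2 - b3, b1 - b2)] restricted to popular [b2 - b3])
   turns this into [|B|^11 m^9 <~ (n |P|)^6 |D|^5].  As [|D| <= X], eliminating
   the parameters leaves [n^26 <~ X^17], and 26/17 = 3/2 + 1/34. *)
From Stdlib Require Import Reals Lra.
From mathcomp Require Import all_boot all_order all_algebra.
From mathcomp Require Import zify ring lra.

Set Implicit Arguments.
Unset Strict Implicit.
Unset Printing Implicit Defensive.

Import Order.TTheory GRing.Theory Num.Theory.

(** * Counting *)

Lemma sum_indicator_eq (T : eqType) (S : seq T) (x : T) (f : T -> nat) :
  uniq S -> \sum_(s <- S) (x == s) * f s = (x \in S) * f x.
Proof.
elim: S => [|s S IH] /=; first by rewrite big_nil.
case/andP=> sS uS; rewrite big_cons IH // in_cons.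
by case: eqVneq => [->|_] //=; rewrite (negPf sS) addn0.
Qed.

Lemma sum_indicator (T : eqType) (S : seq T) (x : T) :
  uniq S -> \sum_(s <- S) (x == s) = (x \in S) :> nat.
Proof.
move=> uS; rewrite -[RHS]muln1 -(sum_indicator_eq x (fun=> 1) uS).
by apply: eq_bigr => s _; rewrite muln1.
Qed.

Lemma sum_nat_count (T : Type) (r : seq T) (a : pred T) :
  \sum_(x <- r) (a x : nat) = count a r.
Proof. by rewrite -sum1_count [RHS]big_mkcond; apply: eq_bigr => x _; case: (a x). Qed.

Lemma count_le1 (T : eqType) (r : seq T) (a : pred T) :
  uniq r -> {in r &, forall x y, a x -> a y -> x = y} -> count a r <= 1.
Proof.
move=> ur inj; rewrite -size_filter.
have: uniq (filter a r) by apply: filter_uniq.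
have: {in filter a r &, forall x y, x = y}.
  move=> x y; rewrite !mem_filter => /andP[ax xr] /andP[ay yr]; exact: inj.
case: (filter a r) => [|x [|y s]] //= same /andP[+ _].
by rewrite inE (same x y) ?eqxx //= !inE eqxx ?orbT.
Qed.

(** By induction: the new cross term [2 * (a * b * S)] is at most [a ^ 2 * G + b ^ 2 * F], by AM-GM
    and the inductive bound on [S ^ 2]. *)
Lemma cauchy_schwarz_nat (T : Type) (r : seq T) (w f g : T -> nat) :
  (\sum_(i <- r) w i * (f i * g i)) ^ 2
    <= (\sum_(i <- r) w i * f i ^ 2) * (\sum_(i <- r) w i * g i ^ 2).
Proof.
elim: r => [|i r IH]; first by rewrite !big_nil.
rewrite !big_cons.
set S := \sum_(j <- r) _ in IH *; set F := \sum_(j <- r) _ in IH *.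
set G := \sum_(j <- r) _ in IH *; set a := f i; set b := g i.
suff: w i * (2 * (a * b * S)) <= w i * (a ^ 2 * G + b ^ 2 * F).
  by move: IH; nia.
rewrite leq_mul2l; apply/orP; right.
rewrite -leq_sqr; apply: leq_trans (nat_AGM2 _ _).
have -> : (2 * (a * b * S)) ^ 2 = 4 * (a ^ 2 * b ^ 2 * S ^ 2) by nia.
rewrite leq_mul2l /=.
have -> : a ^ 2 * G * (b ^ 2 * F) = a ^ 2 * b ^ 2 * (F * G) by nia.
by rewrite leq_mul2l IH orbT.
Qed.

(** The fibres of [h] over [S] partition [r], so Cauchy-Schwarz on their sizes applies; the sum of
    their squares counts collisions. *)
Lemma sqr_size_le_collisions (I K : eqType) (r : seq I) (h : I -> K)
    (S : seq K) :
  uniq S -> {in r, forall i, h i \in S} ->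
  size r ^ 2 <= size S * \sum_(i <- r) \sum_(j <- r) (h i == h j).
Proof.
move=> uS hS; pose fib k := \sum_(i <- r) (h i == k).
have -> : size r = \sum_(k <- S) 1 * (1 * fib k).
  under eq_bigr do rewrite !mul1n.
  rewrite /fib exchange_big /= -sum1_size big_seq [RHS]big_seq.
  by apply: eq_bigr => i ir; rewrite sum_indicator // hS.
apply: leq_trans (cauchy_schwarz_nat _ _ _ _) _.
rewrite leq_mul //; first by rewrite sum1_size.
under eq_bigr => k _ do rewrite mul1n expnS expn1 big_distrlr /=.
rewrite exchange_big /= big_seq [X in _ <= X]big_seq.
apply: leq_sum => i ir; rewrite exchange_big /=.
apply: leq_sum => j _.
rewrite (sum_indicator_eq (h i) (fun k => (h j == k) : nat) uS) hS // mul1n.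
by rewrite eq_sym.
Qed.

(** Write [f i] as the number of levels [k] with [1 <= k <= f i] and exchange the sums. *)
Lemma layer_cake (T : eqType) (r : seq T) (f g : T -> nat) n :
  {in r, forall i, f i <= n} ->
  \sum_(i <- r) f i * g i
    = \sum_(1 <= k < n.+1) \sum_(i <- r | k <= f i) g i.
Proof.
move=> fn; rewrite (eq_bigr (fun k => \sum_(i <- r) (k <= f i) * g i)); last first.
  move=> k _; rewrite big_mkcond; apply: eq_bigr => i _.
  by case: ifP => _; rewrite ?mul1n.
rewrite exchange_big /= big_seq [RHS]big_seq; apply: eq_bigr => i ir.
rewrite -big_distrl /=; congr (_ * _).
rewrite (big_cat_nat (n := (f i).+1)) //=; last by rewrite ltnS fn.
rewrite (eq_big_nat _ _ (F2 := fun=> 1%N)); last first.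
  by move=> k /andP[_]; rewrite ltnS => ->.
rewrite sum_nat_const_nat subn1 muln1 /= big_nat big1 ?addn0 //.
by move=> k /andP[+ _]; rewrite ltnNge => /negPf->.
Qed.

(** * Harmonic sums and popular levels *)

Local Open Scope ring_scope.

(** Each dyadic block from [2 ^ j] to [2 ^ j.+1] contributes at most 1. Every logarithmic loss in
    the development comes from this bound. *)
Lemma harmonic_le (F : realFieldType) n :
  \sum_(1 <= k < n.+1) (k%:R : F)^-1 <= (trunc_log 2 n).+1%:R.
Proof.
have dyadic j : \sum_(1 <= k < (2 ^ j)%N) (k%:R : F)^-1 <= j%:R.
  elim: j => [|j IH]; first by rewrite big_geq.
  rewrite (big_cat_nat (n := (2 ^ j)%N)) ?expn_gt0 ?leq_pexp2l //=.
  rewrite -natr1 lerD //.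
  apply: (@le_trans _ _ (\sum_(2 ^ j <= k < 2 ^ j.+1) ((2 ^ j)%:R : F)^-1)).
    rewrite big_nat_cond [leRHS]big_nat_cond; apply: ler_sum => k.
    rewrite andbT => /andP[kj _]; rewrite lef_pV2 ?ler_nat // posrE ltr0n.
      by apply: leq_trans kj; rewrite expn_gt0.
    by rewrite expn_gt0.
  rewrite sumr_const_nat expnS mul2n -addnn addnK -[_ *+ _]mulr_natr mulVf //.
  by rewrite pnatr_eq0 -lt0n expn_gt0.
apply: le_trans (dyadic _).
have le1 : (n.+1 <= 2 ^ (trunc_log 2 n).+1)%N by exact: trunc_log_ltn.
rewrite [leRHS](big_cat_nat (n := n.+1)) //= lerDl.
by apply: sumr_ge0 => k _; rewrite invr_ge0.
Qed.

Lemma sum_le_harmonic (F : realFieldType) n (g : nat -> F) (M : F) :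
  (forall k, (0 < k <= n)%N -> g k * k%:R <= M) -> 0 <= M ->
  \sum_(1 <= k < n.+1) g k <= M * (trunc_log 2 n).+1%:R.
Proof.
move=> gM M0; apply: le_trans (ler_wpM2l M0 (harmonic_le F n)).
rewrite mulr_sumr big_nat_cond [leRHS]big_nat_cond; apply: ler_sum => k.
rewrite andbT => /andP[k0]; rewrite ltnS => kn.
by rewrite ler_pdivlMr ?ltr0n // gM // k0.
Qed.

Lemma exists_max_level n (g : nat -> nat) : (0 < n)%N ->
  exists2 k, (0 < k <= n)%N & forall j, (0 < j <= n)%N -> (g j <= g k)%N.
Proof.
case: n => // n _.
case: (@arg_maxnP 'I_n.+1 ord0 xpredT (fun i => g i.+1)) => // i _ imax.
exists i.+1; first by rewrite /= ltn_ord.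
move=> [|j] //.
by move=> /andP[_ jn]; have := imax (Ordinal jn) isT.
Qed.

(** Take [k] maximizing [k * count]. By the layer cake formula every level [j] then contributes at
    most this maximum divided by [j], and the harmonic sum costs one logarithm. *)
Lemma popular_level (T : eqType) (r : seq T) (f : T -> nat) n :
  (0 < n)%N -> {in r, forall i, (f i <= n)%N} ->
  exists2 k, (0 < k <= n)%N &
    (\sum_(i <- r) f i
      <= (trunc_log 2 n).+1 * (k * count (fun i => k <= f i) r))%N.
Proof.
move=> n0 fn; pose c k := count (fun i => k <= f i)%N r.
have [k kn kmax] := exists_max_level (fun k => k * c k)%N n0.
exists k => //; rewrite -(ler_nat rat) natrM mulrC.
have := layer_cake (fun=> 1%N) fn; under eq_bigr do rewrite muln1.
move=> ->; rewrite natr_sum; apply: sum_le_harmonic => // j jn.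
by rewrite sum1_count -natrM ler_nat mulnC kmax.
Qed.

(** * Incidences between lines and Cartesian grids *)

Section Blocks.
Variable F : realDomainType.

Definition rank (X : seq F) (x : F) : nat := count (fun y => y < x) X.

Lemma rank_homo X : {homo rank X : x y / x <= y >-> (x <= y)%N}.
Proof. by move=> x y xy; apply: sub_count => z /= /lt_le_trans; apply. Qed.

Lemma rank_lt X x : x \in X -> (rank X x < size X)%N.
Proof.
move=> xX; rewrite -(count_predC (fun y => y < x)) -[ltnLHS]addn0 ltn_add2l.
by rewrite -has_count; apply/hasP; exists x => //=; rewrite ltxx.
Qed.

Lemma rank_inj X : {in X &, injective (rank X)}.
Proof.
have lt_rank x y : x \in X -> x < y -> (rank X x < rank X y)%N.
  move=> xX xy.
  have -> : rank X y = (rank X x + count (fun z => (x <= z) && (z < y))%R X)%N.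
    rewrite /rank -!sum_nat_count -big_split /=; apply: eq_bigr => z _.
    case: (ltP z x) => [zx|_]; last by rewrite add0n.
    by rewrite (lt_trans zx xy).
  rewrite -[ltnLHS]addn0 ltn_add2l -has_count.
  by apply/hasP; exists x; rewrite //= lexx.
move=> x y xX yX; case: (ltgtP x y) => // xy e.
  by have := lt_rank _ _ xX xy; rewrite e ltnn.
by have := lt_rank _ _ yX xy; rewrite e ltnn.
Qed.

(** Blocks are runs of [k.+1] consecutive ranks, so an element shares its block with at most [k]
    others; the successor keeps the division meaningful when [k] is 0. *)
Lemma exists_blocks (X : seq F) (k : nat) : uniq X ->
  exists u : F -> nat,
    [/\ {homo u : x y / x <= y >-> (x <= y)%N},
        {in X, forall x, (u x * k.+1 <= size X)%N} &
        {in X, forall x,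
           (count (fun x' => (x' != x) && (u x' == u x)) X <= k)%N}].
Proof.
move=> uX; exists (fun x => rank X x %/ k.+1)%N; split.
- by move=> x y xy; rewrite leq_div2r // rank_homo.
- by move=> x xX; apply: leq_trans (leq_divM _ _) (ltnW (rank_lt xX)).
move=> x xX; set j := (rank X x %/ k.+1)%N.
have inblk x' : x' \in X -> (rank X x' %/ k.+1)%N == j ->
    rank X x' \in iota (j * k.+1) k.+1.
  move=> _ /eqP <-; rewrite mem_iota leq_divM /=.
  by rewrite {1}(divn_eq (rank X x') k.+1) ltn_add2l ltn_pmod.
have : (count (fun x' => rank X x' %/ k.+1 == j)%N X <= k.+1)%N.
  rewrite -size_filter -(size_map (rank X)) -[leqRHS](size_iota (j * k.+1)).
  apply: uniq_leq_size => [|r /mapP[x' + ->]].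
    rewrite map_inj_in_uniq ?filter_uniq // => y z.
    by rewrite !mem_filter => /andP[_ yX] /andP[_ zX]; apply: rank_inj.
  by rewrite mem_filter => /andP[e x'X]; apply: inblk.
rewrite -!sum_nat_count !(bigD1_seq x) //= /j !eqxx /= add0n add1n ltnS.
by apply: leq_trans; apply: leq_sum => y ->.
Qed.

End Blocks.

Section Incidences.
Variable F : archiRcfType.

(* A pair [l] encodes the line [y = l.1 * x - l.2]. *)
Definition incid (X Y : seq F) (l : F * F) : nat :=
  count (fun x => l.1 * x - l.2 \in Y) X.

(* A non-axis-parallel line crosses the blocks of the grid monotonically, so it
   meets at most [r + s + 1] of them. *)
Lemma incid_sqr_le (X Y : seq F) (u v : F -> nat) (r s : nat) (l : F * F) :
  {homo u : x y / x <= y >-> (x <= y)%N} ->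
  {homo v : x y / x <= y >-> (x <= y)%N} ->
  {in X, forall x, (u x <= r)%N} -> {in Y, forall y, (v y <= s)%N} ->
  l.1 != 0 ->
  (incid X Y l ^ 2 <= (r + s).+1 *
     \sum_(x <- [seq x <- X | (l.1 * x - l.2)%R \in Y])
     \sum_(x' <- [seq x <- X | (l.1 * x - l.2)%R \in Y])
     ((u x == u x') && (v (l.1 * x - l.2) == v (l.1 * x' - l.2))%R))%N.
Proof.
move=> um vm ur vs l0; rewrite /incid -size_filter.
set Z := [seq x <- X | _].
pose y x := l.1 * x - l.2.
(* Along the line [u] increases with [x], and [v] increases or decreases with the sign of the slope.
   After reversing [v] for negative slope, the sum [w] alone determines the block, and it takes at
   most [r + s + 1] values. *)
pose w x := if 0 < l.1 then (u x + v (y x))%N else (u x + (s - v (y x)))%N.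
have mZ x : x \in Z -> (u x <= r)%N /\ (v (y x) <= s)%N.
  by rewrite mem_filter => /andP[yY xX]; rewrite ur ?vs.
have ws : {in Z, forall x, w x \in iota 0 (r + s).+1}.
  move=> x /mZ[ux vx]; rewrite mem_iota /= add0n ltnS /w.
  by case: ifP => _; rewrite leq_add ?leq_subr.
apply: leq_trans (sqr_size_le_collisions (iota_uniq _ _) ws) _.
rewrite size_iota leq_mul2l /= big_seq [leqRHS]big_seq.
apply: leq_sum => x xZ; rewrite big_seq [leqRHS]big_seq.
apply: leq_sum => x' x'Z; case: (w x =P w x') => // ww.
suff [-> ->] : u x = u x' /\ v (y x) = v (y x') by rewrite !eqxx.
have [_ v1] := mZ _ xZ; have [_ v2] := mZ _ x'Z.
wlog xx' : x x' xZ x'Z ww v1 v2 / x <= x'.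
  move=> H; case: (leP x x') => [xx'|/ltW xx']; first exact: H.
  by have [] := H x' x x'Z xZ (esym ww) v2 v1 xx'.
have u12 := um _ _ xx'; move: ww; rewrite /w; case: ifP => l1.
  have : (v (y x) <= v (y x'))%N.
    by apply: vm; rewrite lerD2r ler_pM2l.
  by move=> v12 ww; split; lia.
have l1' : l.1 < 0 by rewrite lt_neqAle l0 leNgt l1.
have : (v (y x') <= v (y x))%N.
  by apply: vm; rewrite lerD2r ler_nM2l.
by move=> v12 ww; split; lia.
Qed.

(* Two points with distinct abscissae lie on at most one line. *)
Lemma sum_close_pairs_le (X Y : seq F) (L : seq (F * F)) (u v : F -> nat)
    (kx ky : nat) :
  uniq X -> uniq Y -> uniq L -> {in L, forall l, l.1 != 0} ->
  {in X, forall x,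
     (count (fun x' => (x' != x) && (u x' == u x)) X <= kx)%N} ->
  {in Y, forall y,
     (count (fun y' => (y' != y) && (v y' == v y)) Y <= ky)%N} ->
  (\sum_(l <- L) \sum_(x <- [seq x <- X | (l.1 * x - l.2)%R \in Y])
     \sum_(x' <- [seq x <- X | (l.1 * x - l.2)%R \in Y])
       [&& x' != x, u x' == u x &
           v (l.1 * x' - l.2)%R == v (l.1 * x - l.2)%R]
   <= size X * kx * (size Y * ky))%N.
Proof.
move=> uX uY uL L0 ux vy.
pose on (l : F * F) (x y : F) := l.1 * x - l.2 == y.
pose near (f : F -> nat) (x x' : F) := (x' != x) && (f x' == f x).
(* Sum over all pairs of grid points, so that for each pair the lines through both can be counted
   first. *)
have step1 : (\sum_(l <- L) \sum_(x <- [seq x <- X | (l.1 * x - l.2)%R \in Y])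
     \sum_(x' <- [seq x <- X | (l.1 * x - l.2)%R \in Y])
       [&& x' != x, u x' == u x &
           v (l.1 * x' - l.2)%R == v (l.1 * x - l.2)%R]
   <= \sum_(l <- L) \sum_(x <- X) \sum_(x' <- X) \sum_(y <- Y) \sum_(y' <- Y)
     (on l x y && on l x' y') * (near u x x' && near v y y'))%N.
  rewrite big_seq [leqRHS]big_seq; apply: leq_sum => l lL.
  rewrite big_filter big_mkcond; apply: leq_sum => x _.
  case: ifP => // yY; rewrite big_filter big_mkcond; apply: leq_sum => x' _.
  case: ifP => // y'Y.
  case: (boolP [&& _, _ & _]) => // /and3P[xx eu ev].
  rewrite (bigD1_seq (l.1 * x - l.2)) //= (bigD1_seq (l.1 * x' - l.2)) //=.
  rewrite /on !eqxx /near xx eu ev !andbT /=.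
  have -> : l.1 * x' - l.2 != l.1 * x - l.2.
    by apply: contra xx => /eqP/addIr/(mulfI (L0 _ lL)) ->.
  by [].
apply: leq_trans step1 _.
rewrite exchange_big /=.
under eq_bigr => x _.
  rewrite exchange_big /=.
  under eq_bigr => x' _.
    rewrite exchange_big /=.
    under eq_bigr => y _ do rewrite exchange_big /=.
    over.
  over.
apply: (@leq_trans (\sum_(x <- X) \sum_(x' <- X) \sum_(y <- Y) \sum_(y' <- Y)
   (near u x x' * near v y y')))%N.
  apply: leq_sum => x _; apply: leq_sum => x' _.
  apply: leq_sum => y _; apply: leq_sum => y' _.
  rewrite -big_distrl /= -mulnb; case: (boolP (near u x x')) => [|_]; last first.
    by rewrite muln0.
  move=> /andP[xx _]; rewrite mul1n -[leqRHS]mul1n leq_mul2r; apply/orP; right.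
  (* Distinct abscissae determine the slope, and then the intercept. *)
  rewrite sum_nat_count; apply: count_le1 => // [] [p c] [p' c'] _ _ /=.
  rewrite /on /= => /andP[/eqP e1 /eqP e2] /andP[/eqP e3 /eqP e4].
  have xx0 : x' - x != 0 by rewrite subr_eq0.
  have pp : p = p'.
    apply: (mulIf xx0); rewrite !mulrBr.
    have -> : p * x' = y' + c by rewrite -e2; ring.
    have -> : p * x = y + c by rewrite -e1; ring.
    have -> : p' * x' = y' + c' by rewrite -e4; ring.
    have -> : p' * x = y + c' by rewrite -e3; ring.
    ring.
  by congr pair => //; move: e1; rewrite -e3 pp => /addrI/oppr_inj.
apply: (@leq_trans (\sum_(x <- X) \sum_(x' <- X)
    near u x x' * (size Y * ky)))%N.
  apply: leq_sum => x _; apply: leq_sum => x' _.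
  apply: (@leq_trans (near u x x' * \sum_(y <- Y) \sum_(y' <- Y) near v y y'))%N.
    rewrite big_distrr /=; apply: leq_sum => y _; by rewrite big_distrr /=.
  rewrite leq_mul2l; apply/orP; right.
  rewrite -sum1_size big_distrl /= big_seq [leqRHS]big_seq.
  by apply: leq_sum => y yY; rewrite mul1n sum_nat_count vy.
under eq_bigr => x _ do rewrite -big_distrl /=.
rewrite -big_distrl /= leq_mul2r; apply/orP; right.
rewrite -sum1_size big_distrl /= big_seq [leqRHS]big_seq.
by apply: leq_sum => x xX; rewrite mul1n sum_nat_count ux.
Qed.

End Incidences.

(** * Szemeredi-Trotter bounds for grids *)

Section SzemerediTrotter.
Variable F : archiRcfType.

Lemma block_size_bounds (n : nat) (rho : F) : 0 < rho ->
  let k := Num.truncn (n%:R / rho) in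
  (k%:R <= n%:R / rho) /\ (((n %/ k.+1)%N)%:R <= rho).
Proof.
move=> rho0 k.
have /andP[k1 k2] := truncn_itv (divr_ge0 (ler0n F n) (ltW rho0)).
split=> //; rewrite -/k in k1 k2.
have : (n %/ k.+1 * k.+1)%:R <= rho * k.+1%:R.
  apply: (@le_trans _ _ n%:R); first by rewrite ler_nat leq_divM.
  by move: k2; rewrite ltr_pdivrMr // mulrC => /ltW.
by rewrite natrM ler_pM2r // ltr0n.
Qed.

(** [W] bounds the number of blocks a line meets, and [q l] counts ordered pairs of distinct
    incidences of [l] in a common block. The remaining term [incid X Y l] is the diagonal. *)
Lemma incid_excess (X Y : seq F) (L : seq (F * F)) (rho : F) :
  uniq X -> uniq Y -> uniq L -> {in L, forall l, l.1 != 0} -> 0 < rho ->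
  exists (W : nat) (q : F * F -> nat),
    [/\ W%:R <= 2 * rho + 1,
        (\sum_(l <- L) q l)%N%:R
          <= ((size X)%:R * (size Y)%:R / rho) ^+ 2 &
        {in L, forall l, (incid X Y l ^ 2 <= W * (incid X Y l + q l))%N}].
Proof.
move=> uX uY uL L0 rho0.
have [kx1 kx2] := block_size_bounds (size X) rho0.
have [ky1 ky2] := block_size_bounds (size Y) rho0.
move: kx1 kx2 ky1 ky2; set kx := Num.truncn _; set ky := Num.truncn _.
move=> kx1 kx2 ky1 ky2.
have [u [um ur uk]] := exists_blocks kx uX.
have [v [vm vr vk]] := exists_blocks ky uY.
exists (size X %/ kx.+1 + size Y %/ ky.+1).+1.
exists (fun l => \sum_(x <- [seq x <- X | (l.1 * x - l.2)%R \in Y])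
     \sum_(x' <- [seq x <- X | (l.1 * x - l.2)%R \in Y])
       [&& x' != x, u x' == u x &
           v (l.1 * x' - l.2)%R == v (l.1 * x - l.2)%R])%N.
split.
- rewrite -natr1 natrD lerD2r; lra.
- apply: (@le_trans _ _ (size X * kx * (size Y * ky))%N%:R).
    by rewrite ler_nat; apply: sum_close_pairs_le.
  have -> : ((size X)%:R * (size Y)%:R / rho) ^+ 2
    = (size X)%:R * ((size X)%:R / rho) * ((size Y)%:R * ((size Y)%:R / rho)).
    by rewrite expr2; ring.
  by rewrite !natrM ler_pM ?mulr_ge0 ?ler_wpM2l.
move=> l lL.
have := @incid_sqr_le F X Y u v (size X %/ kx.+1) (size Y %/ ky.+1) l um vm.
move=> /(_ _ _ (L0 _ lL)) H; apply: leq_trans (H _ _) _.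
- by move=> x xX; rewrite leq_divRL // ur.
- by move=> y yY; rewrite leq_divRL // vr.
rewrite leq_mul2l /= /incid -size_filter -sum1_size -big_split /=.
have uZ : uniq [seq x <- X | l.1 * x - l.2 \in Y] by rewrite filter_uniq.
rewrite big_seq [leqRHS]big_seq; apply: leq_sum => x xZ.
rewrite (bigD1_seq x) //= [X in (_ <= 1 + X)%N](bigD1_seq x) //= !eqxx /=.
rewrite add0n leq_add2l; apply: leq_sum => x' ->.
by rewrite eq_sym [X in _ && X]eq_sym.
Qed.

Lemma incid_second_moment (X Y : seq F) (L : seq (F * F)) (rho : F) :
  uniq X -> uniq Y -> uniq L -> {in L, forall l, l.1 != 0} -> 0 < rho ->
  (\sum_(l <- L) incid X Y l ^ 2)%N%:R <= (2 * rho + 1) *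
    ((\sum_(l <- L) incid X Y l)%N%:R + ((size X)%:R * (size Y)%:R / rho) ^+ 2).
Proof.
move=> uX uY uL L0 rho0.
have [W [q [W1 q1 iW]]] := incid_excess uX uY uL L0 rho0.
apply: (@le_trans _ _ (W%:R * (\sum_(l <- L) incid X Y l
                               + \sum_(l <- L) q l)%N%:R)).
  rewrite -natrM ler_nat -big_split /= big_distrr /= big_seq [leqRHS]big_seq.
  exact: leq_sum.
by rewrite natrD ler_pM ?addr_ge0 // lerD2l.
Qed.

(** A line with at most [2 * W] incidences is paid for by the first term. A richer one has [incid ^
    2 <= W * (incid + q) <= incid * (incid + q) / 2], hence [incid <= q]. *)
Lemma szemeredi_trotter_grid (X Y : seq F) (L : seq (F * F)) (rho : F) :
  uniq X -> uniq Y -> uniq L -> {in L, forall l, l.1 != 0} -> 0 < rho ->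
  (\sum_(l <- L) incid X Y l)%N%:R <= 2 * (2 * rho + 1) * (size L)%:R
    + ((size X)%:R * (size Y)%:R / rho) ^+ 2.
Proof.
move=> uX uY uL L0 rho0.
have [W [q [W1 q1 iW]]] := incid_excess uX uY uL L0 rho0.
apply: (@le_trans _ _ (2 * W * size L + \sum_(l <- L) q l)%N%:R); last first.
  by rewrite natrD lerD // !natrM ler_wpM2r // ler_wpM2l.
rewrite ler_nat -sum1_size big_distrr -big_split /= big_seq [leqRHS]big_seq.
apply: leq_sum => l lL; have := iW _ lL.
case: (leqP (incid X Y l) (2 * W)%N) => [|lt le]; first by lia.
have : (incid X Y l * incid X Y l <= incid X Y l * (2 * q l))%N by nia.
rewrite leq_mul2l; case: (incid X Y l) lt le => //= i lt le; nia.
Qed.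

End SzemerediTrotter.

(** * Popular ratios *)

Section Ratios.
Variable F : archiRcfType.

Lemma incidE (X Y : seq F) (l : F * F) : uniq Y ->
  incid X Y l = (\sum_(x <- X) \sum_(y <- Y) (l.1 * x - y == l.2)%R)%N.
Proof.
move=> uY; rewrite /incid -sum_nat_count; apply: eq_bigr => x _.
rewrite -sum_indicator //; apply: eq_bigr => y _.
by rewrite !subr_eq addrC.
Qed.

(* The number of [(b, b', c, c')] in [A^4] with [x * (b - c) = b' - c']. *)
Definition dilate_energy (A : seq F) (x : F) : nat :=
  (\sum_(b <- A) \sum_(b' <- A) incid A A (x, x * b - b')%R)%N.

(** The energy of [x] is the second moment of the incidences of [A x A] with the lines of slope [x],
    so the second moment bound for grids applies to all slopes in [P] at once. *)
Lemma sum_dilate_energy_le (A P : seq F) :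
  uniq A -> uniq P -> {in P, forall x, x != 0} -> (size P <= size A ^ 2)%N ->
  (\sum_(x <- P) dilate_energy A x)%N%:R
    <= 6 * (size A)%:R ^+ 3 * Num.sqrt (size P)%:R :> F.
Proof.
move=> uA uP P0 szP.
have [/size0nil ->|sP0] := posnP (size P); first by rewrite big_nil !mulr_ge0 ?sqrtr_ge0.
have sA0 : (0 < size A)%N by move: szP; case: (size A) => //; lia.
pose T := undup [seq x * bb.1 - bb.2 | x <- P, bb <- [seq (b, b') | b <- A, b' <- A]].
have inT x b b' : x \in P -> b \in A -> b' \in A -> x * b - b' \in T.
  move=> xP bA b'A; rewrite mem_undup; apply/allpairsP.
  by exists (x, (b, b')); split=> //; apply: allpairs_f.
have uT : uniq T by apply: undup_uniq.
pose L := [seq (x, t) | x <- P, t <- T].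
have uL : uniq L by apply: allpairs_uniq => // [] [? ?] [? ?] _ _ [-> ->].
have L0 : {in L, forall l, l.1 != 0}.
  by move=> l /allpairsP[[x t] /= [xP _ ->]]; apply: P0.
set s := Num.sqrt _; set n : F := (size A)%:R.
have n0 : 0 < n by rewrite ltr0n.
have ss : s ^+ 2 = (size P)%:R by rewrite sqr_sqrtr.
have s0 : 0 < s by rewrite sqrtr_gt0 ltr0n.
have sn : s <= n by rewrite -ler_sqr ?nnegrE ?(ltW s0) ?(ltW n0) // ss /n -natrX ler_nat.
(* The choice [rho = n / s] makes both terms of the second moment bound equal to [s ^ 2 * n ^ 2];
   [s <= n] gives [rho >= 1], so [2 * rho + 1 <= 3 * rho]. *)
have rho0 : 0 < n / s by apply: divr_gt0.
have := incid_second_moment uA uA uL L0 rho0.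
have -> : (\sum_(l <- L) incid A A l ^ 2 = \sum_(x <- P) dilate_energy A x)%N.
  rewrite big_allpairs /= big_seq [RHS]big_seq; apply: eq_bigr => x xP.
  transitivity (\sum_(t <- T) \sum_(b <- A) \sum_(b' <- A)
                  (x * b - b' == t)%R * incid A A (x, t))%N.
    apply: eq_bigr => t _; rewrite expnS expn1 {1}incidE // big_distrl /=.
    by apply: eq_bigr => b _; rewrite big_distrl.
  rewrite exchange_big /= /dilate_energy big_seq [RHS]big_seq.
  apply: eq_bigr => b bA; rewrite exchange_big big_seq [RHS]big_seq.
  apply: eq_bigr => b' b'A.
  by rewrite (sum_indicator_eq _ (fun t => incid A A (x, t))) // inT ?mul1n.
move/le_trans; apply.
(* For a fixed slope each of the [n ^ 2] points lies on at most one line. *)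
have le2 : (\sum_(l <- L) incid A A l)%N%:R <= s ^+ 2 * n ^+ 2.
  rewrite ss /n -natrX -natrM ler_nat big_allpairs /= -sum1_size big_distrl /=.
  apply: leq_sum => x _; under eq_bigr => t _ do rewrite incidE //=.
  rewrite exchange_big mul1n /= expnS expn1.
  rewrite -[X in (X * _)%N]sum1_size big_distrl /=; apply: leq_sum => b _.
  rewrite exchange_big mul1n /= -[leqRHS]sum1_size; apply: leq_sum => b' _.
  by rewrite sum_indicator // leq_b1.
apply: (@le_trans _ _ (3 * (n / s) * (s ^+ 2 * n ^+ 2 + (n * n / (n / s)) ^+ 2))).
  apply: ler_pM => //; first by have := ltW rho0; lra.
  - by rewrite addr_ge0 ?sqr_ge0.
  - by have : 1 <= n / s by [rewrite ler_pdivlMr ?mul1r]; lra.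
  - by rewrite lerD2r.
have -> : n * n / (n / s) = n * s by field; rewrite !gt_eqF.
have -> : 3 * (n / s) * (s ^+ 2 * n ^+ 2 + (n * s) ^+ 2) = 6 * n ^+ 3 * s.
  by field; rewrite gt_eqF.
exact: lexx.
Qed.

Definition ratio_rep (A : seq F) (x : F) : nat :=
  (\sum_(q <- A) \sum_(a <- A) (x * q == a)%R)%N.

(** With [x = a / a'], the equation [a (b - c) = a' (b' - c')] becomes [x b - b' = x c - c']: the
    points [(b, b')] and [(c, c')] lie on a common line of slope [x]. *)
Lemma collisions_eq_ratio_sum (A : seq F) : uniq A -> 0 \notin A ->
  let Q := undup [seq a / a' | a <- A, a' <- A] in
  let triples := [seq (a, bc) | a <- A, bc <- [seq (b, c) | b <- A, c <- A]] in
  let h (t : F * (F * F)) := t.1 * (t.2.1 - t.2.2) in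
  (\sum_(t <- triples) \sum_(t' <- triples) (h t == h t')
    = \sum_(x <- Q) ratio_rep A x * dilate_energy A x)%N.
Proof.
move=> uA A0 Q triples h.
have nz a : a \in A -> a != 0 by apply: contraTneq => ->.
transitivity (\sum_(a <- A) \sum_(a' <- A) dilate_energy A (a / a')%R)%N.
  rewrite big_allpairs /= big_seq [RHS]big_seq; apply: eq_bigr => a aA.
  transitivity (\sum_(bc <- [seq (b, c) | b <- A, c <- A])
    \sum_(a' <- A) \sum_(bc' <- [seq (b, c) | b <- A, c <- A])
      (h (a, bc) == h (a', bc')))%N.
    by apply: eq_bigr => bc _; rewrite big_allpairs.
  rewrite exchange_big /= big_seq [RHS]big_seq; apply: eq_bigr => a' a'A.
  rewrite big_allpairs /dilate_energy; apply: eq_bigr => b _ /=.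
  transitivity (\sum_(c <- A) \sum_(b' <- A) \sum_(c' <- A)
      (h (a, (b, c)) == h (a', (b', c'))))%N.
    by apply: eq_bigr => c _; rewrite big_allpairs.
  rewrite exchange_big /=; apply: eq_bigr => b' _.
  rewrite incidE //=; apply: eq_bigr => c _; apply: eq_bigr => c' _.
  congr (nat_of_bool _); rewrite /h /=.
  apply/eqP/eqP => [e|e].
    have -> : c' = b' - a * (b - c) / a'.
      by rewrite e; field; rewrite nz.
    by field; rewrite nz.
  have -> : c' = a / a' * c - (a / a' * b - b') by rewrite -e; ring.
  by field; rewrite nz.
transitivity (\sum_(a <- A) \sum_(a' <- A) \sum_(x <- Q)
   (a / a' == x)%R * dilate_energy A x)%N.
  rewrite big_seq [RHS]big_seq; apply: eq_bigr => a aA.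
  rewrite big_seq [RHS]big_seq; apply: eq_bigr => a' a'A.
  have inQ : a / a' \in Q.
    by rewrite mem_undup; apply/allpairsP; exists (a, a').
  by rewrite (sum_indicator_eq _ _ (undup_uniq _)) inQ mul1n.
under eq_bigr => a _ do rewrite exchange_big /=.
rewrite exchange_big /=; apply: eq_bigr => x _.
rewrite /ratio_rep [in RHS]exchange_big big_distrl /=.
apply: eq_bigr => a _; rewrite big_distrl /= big_seq [RHS]big_seq.
apply: eq_bigr => a' a'A; congr (nat_of_bool _ * _)%N.
have a'0 := nz _ a'A; apply/eqP/eqP => [<-|<-]; first by rewrite divfK.
by rewrite mulfK.
Qed.

Lemma popular_ratios (A Z : seq F) : uniq A -> 0 \notin A -> (0 < size A)%N ->
  uniq Z ->
  {in A, forall a, {in A, forall b, {in A, forall c, a * (b - c) \in Z}}} ->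
  exists (k : nat) (P : seq F),
    [/\ uniq P, {in P, forall x, x != 0}, {in P, forall x, (k <= ratio_rep A x)%N},
        (size P * k <= size A ^ 2)%N &
        (size A ^ 6 <= 36 * size Z ^ 2 * (trunc_log 2 (size A)).+1 ^ 2
           * (size P * k ^ 2))%N].
Proof.
move=> uA A0 sA0 uZ hZ; set n := size A; set H := (trunc_log 2 n).+1.
have nz a : a \in A -> a != 0 by apply: contraTneq => ->.
pose Q := undup [seq a / a' | a <- A, a' <- A].
have uQ : uniq Q by apply: undup_uniq.
have Q0 : {in Q, forall x, x != 0}.
  move=> x; rewrite mem_undup => /allpairsP[[a a'] /= [aA a'A ->]].
  by rewrite mulf_neq0 ?invr_eq0 ?nz.
have sQ : (size Q <= n ^ 2)%N.
  by apply: leq_trans (size_undup _) _; rewrite size_allpairs.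
have rn x : (ratio_rep A x <= n)%N.
  rewrite /ratio_rep /n -sum1_size; apply: leq_sum => q _.
  by rewrite sum_indicator // leq_b1.
pose P k := [seq x <- Q | (k <= ratio_rep A x)%N].
(* The energy bound involves the square root of the number of ratios, so maximizing
   [size (P k) * k ^ 2] bounds level [j] by a constant over [j]. *)
have [k kn kmax] := exists_max_level (fun k => size (P k) * k ^ 2)%N sA0.
have PQ j : {subset P j <= Q} by move=> x; rewrite mem_filter => /andP[].
have Pr j : {in P j, forall x, (j <= ratio_rep A x)%N}.
  by move=> x; rewrite mem_filter => /andP[].
have uP j : uniq (P j) by rewrite filter_uniq.
exists k, (P k); split => //.
- by move=> x /PQ; apply: Q0.
(* A pair [(q, a)] represents only one ratio, so the representations number at most [n ^ 2] in
   total. *)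
- apply: (@leq_trans (\sum_(x <- P k) ratio_rep A x)%N).
    rewrite -sum1_size big_distrl /= big_seq [leqRHS]big_seq.
    by apply: leq_sum => x xP; rewrite mul1n Pr.
  rewrite /ratio_rep exchange_big /= expnS expn1 -[X in (X * _)%N]sum1_size.
  rewrite big_distrl /= big_seq [leqRHS]big_seq; apply: leq_sum => q qA.
  rewrite exchange_big mul1n -[leqRHS]sum1_size; apply: leq_sum => a _.
  rewrite sum_nat_count; apply: count_le1 => // x y _ _ /= /eqP xa /eqP ya.
  by apply: (mulIf (nz _ qA)); rewrite xa ya.
set M := (size (P k) * k ^ 2)%N.
set triples := [seq (a, bc) | a <- A, bc <- [seq (b, c) | b <- A, c <- A]].
pose h (t : F * (F * F)) := t.1 * (t.2.1 - t.2.2).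
have hT : {in triples, forall t, h t \in Z}.
  move=> t /allpairsP[[a bc] /= [aA /allpairsP[[b c] /= [bA cA ->]] ->]].
  exact: hZ.
have := sqr_size_le_collisions uZ hT.
rewrite collisions_eq_ratio_sum // (_ : size triples = (n ^ 3)%N); last first.
  by rewrite !size_allpairs -/n; lia.
rewrite (@layer_cake _ _ _ _ n); last by move=> x _; apply: rn.
set S := (\sum_(1 <= _ < _) _)%N => le1.
have leS : S%:R <= (6 * n%:R ^+ 3 * Num.sqrt M%:R) * H%:R :> F.
  rewrite natr_sum; apply: sum_le_harmonic => [j jn|]; last first.
    by rewrite !mulr_ge0 ?sqrtr_ge0.
  rewrite -big_filter -/(P j).
  have sPj : (size (P j) <= n ^ 2)%N by apply: leq_trans sQ; apply: uniq_leq_size.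
  have Pj0 : {in P j, forall x, x != 0} by move=> x /PQ; apply: Q0.
  apply: le_trans (ler_wpM2r (ler0n F j) (sum_dilate_energy_le uA (uP j) Pj0 sPj)) _.
  rewrite -/n -[leLHS]mulrA; apply: ler_wpM2l; first by rewrite mulr_ge0 ?exprn_ge0.
  have -> : j%:R = Num.sqrt (j ^ 2)%N%:R :> F by rewrite natrX sqrtr_sqr ger0_norm.
  by rewrite -sqrtrM // -natrM ler_wsqrtr // ler_nat kmax.
have n0 : 0 < n%:R :> F by rewrite ltr0n.
have le2 : n%:R ^+ 3 <= 6 * (size Z)%:R * H%:R * Num.sqrt M%:R :> F.
  have n30 : 0 < n%:R ^+ 3 :> F by rewrite exprn_gt0.
  rewrite -(ler_pM2r n30) -expr2 -!natrX.
  apply: (@le_trans _ _ (size Z * S)%N%:R); first by rewrite ler_nat.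
  rewrite natrM; apply: le_trans (ler_wpM2l _ leS) _ => //.
  by rewrite le_eqVlt; apply/orP; left; apply/eqP; rewrite natrX; ring.
have := lerXn2r 2 _ _ le2; rewrite !nnegrE exprn_ge0 // !mulr_ge0 ?sqrtr_ge0 //.
move=> /(_ isT isT) le3; rewrite -(ler_nat F).
have -> : (36 * size Z ^ 2 * H ^ 2 * M)%N%:R
    = (6 * (size Z)%:R * H%:R * Num.sqrt M%:R) ^+ 2 :> F.
  by rewrite [RHS]exprMn sqr_sqrtr // !natrM; ring.
by apply: le_trans le3; rewrite natrX -exprM.
Qed.

End Ratios.

(** * Differences of sets with many product representations *)

Section RichDifferences.
Variable F : archiRcfType.

Definition diff_rep (B C : seq F) (s : F) : nat :=
  (\sum_(b <- B) \sum_(c <- C) (b - c == s)%R)%N.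

Definition prod_rep (P Q : seq F) (a : F) : nat :=
  (\sum_(p <- P) \sum_(q <- Q) (p * q == a)%R)%N.

Lemma diff_rep_lel (B C : seq F) s : uniq C -> (diff_rep B C s <= size B)%N.
Proof.
move=> uC; rewrite /diff_rep -sum1_size; apply: leq_sum => b _.
rewrite sum_nat_count; apply: count_le1 => // c c' _ _ /eqP <- /eqP.
by move/addrI/oppr_inj.
Qed.

Lemma diff_rep_ler (B C : seq F) s : uniq B -> (diff_rep B C s <= size C)%N.
Proof.
move=> uB; rewrite /diff_rep exchange_big -sum1_size; apply: leq_sum => c _.
rewrite sum_nat_count; apply: count_le1 => // b b' _ _ /eqP <- /eqP.
by move/addIr.
Qed.

Lemma prod_rep_le (P A : seq F) a : uniq P -> 0 \notin A ->
  (prod_rep P A a <= size A)%N.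
Proof.
move=> uP A0; rewrite /prod_rep exchange_big -sum1_size big_seq [leqRHS]big_seq.
apply: leq_sum => q qA; rewrite sum_nat_count; apply: count_le1 => // p p' _ _.
have q0 : q != 0 by apply: contraTneq qA => ->.
by move=> /eqP <- /eqP /(mulIf q0).
Qed.

Lemma sum_prod_rep_le (P A B : seq F) : uniq B ->
  (\sum_(b <- B) prod_rep P A b <= size P * size A)%N.
Proof.
move=> uB; rewrite /prod_rep exchange_big -sum1_size big_distrl /=.
apply: leq_sum => p _; rewrite exchange_big mul1n -sum1_size.
by apply: leq_sum => q _; rewrite sum_indicator // leq_b1.
Qed.

(** If [s = b - c] and [b = p q], then the point [(q, s)] of [A x S] lies on the line [(p, c)]. Each
    such incidence determines [b], and each [b] has at least [m] factorizations. *)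
Lemma rich_diff_incid (A B C P S : seq F) (m : nat) : uniq B -> uniq S ->
  {in B, forall b, (m <= prod_rep P A b)%N} ->
  (m * \sum_(s <- S) diff_rep B C s
     <= \sum_(l <- [seq (p, c) | p <- P, c <- C]) incid A S l)%N.
Proof.
move=> uB uS mB; rewrite big_allpairs [leqRHS]exchange_big /=.
under [leqRHS]eq_bigr => c _.
  under eq_bigr => p _ do rewrite incidE // exchange_big /=.
  rewrite exchange_big /=.
  over.
rewrite [leqRHS]exchange_big /= big_distrr /=; apply: leq_sum => s _.
rewrite /diff_rep exchange_big big_distrr /=; apply: leq_sum => c _.
apply: (@leq_trans (\sum_(b <- B) \sum_(p <- P) \sum_(q <- A)
                      (p * q == b)%R * (b - c == s)%R))%N.
  rewrite big_distrr /= big_seq [leqRHS]big_seq; apply: leq_sum => b bB.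
  under eq_bigr => p _ do rewrite -big_distrl /=.
  by rewrite -big_distrl /= leq_mul2r mB ?orbT.
rewrite exchange_big /=; apply: leq_sum => p _.
rewrite exchange_big /=; apply: leq_sum => q _.
rewrite (sum_indicator_eq _ (fun b => (b - c == s)%R : nat)) //.
apply: (@leq_trans (p * q - c == s)%R); first by case: (_ \in B); rewrite ?mul1n ?mul0n.
by rewrite !subr_eq addrC.
Qed.

(** Apply the grid bound to [A x S] and the lines indexed by [P x C], which have at least
    [m * t * size S] incidences. *)
Lemma rich_diff_le (A B C P S : seq F) (m t : nat) :
  uniq A -> uniq B -> uniq C -> uniq P -> uniq S ->
  0 \notin A -> {in P, forall p, p != 0} ->
  {in B, forall b, (m <= prod_rep P A b)%N} ->
  {in S, forall s, (t <= diff_rep B C s)%N} ->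
  (size S * (m * t) ^ 3 <= 288 * (size A * (size P * size C)) ^ 2)%N.
Proof.
move=> uA uB uC uP uS A0 P0 mB tS.
have [->|w0] := posnP (m * t); first by rewrite exp0n // muln0.
have [->|S0] := posnP (size S); first by rewrite mul0n.
have [s0 s0S] : exists s, s \in S.
  by case: (S) S0 => // s S' _; exists s; rewrite mem_head.
have tB := leq_trans (tS _ s0S) (diff_rep_lel B s0 uC).
have tC := leq_trans (tS _ s0S) (diff_rep_ler C s0 uB).
have [t0 m0] : (0 < t)%N /\ (0 < m)%N by move: w0; rewrite muln_gt0 => /andP[].
have mA : (m <= size A)%N.
  have [b bB] : exists b, b \in B.
    by case: (B) (leq_trans t0 tB) => // b B' _; exists b; rewrite mem_head.
  exact: leq_trans (mB _ bB) (prod_rep_le b uP A0).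
have mBP : (m * size B <= size P * size A)%N.
  apply: leq_trans (sum_prod_rep_le P A uB).
  rewrite mulnC -sum1_size big_distrl /= big_seq [leqRHS]big_seq.
  by apply: leq_sum => b bB; rewrite mul1n mB.
(* This trivial bound, from [m <= size A], [t <= size B], [t <= size C] and
   [m * size B <= size P * size A], settles the case [rho < 1] below. *)
have w2 : ((m * t) ^ 2 <= size A ^ 2 * (size P * size C))%N.
  have h1 : (m * t * t <= size P * size A * size C)%N.
    by rewrite leq_mul // (leq_trans _ mBP) // leq_mul2l tB orbT.
  have -> : ((m * t) ^ 2 = m * (m * t * t))%N by lia.
  have -> : (size A ^ 2 * (size P * size C)
             = size A * (size P * size A * size C))%N by lia.
  exact: leq_mul.
have uL : uniq [seq (p, c) | p <- P, c <- C].
  by apply: allpairs_uniq => // [] [? ?] [? ?] _ _ [-> ->].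
have L0 : {in [seq (p, c) | p <- P, c <- C], forall l, l.1 != 0}.
  by move=> l /allpairsP[[p c] /= [pP _ ->]]; apply: P0.
have wS : (m * t * size S
    <= \sum_(l <- [seq (p, c) | p <- P, c <- C]) incid A S l)%N.
  apply: leq_trans (rich_diff_incid C uB uS mB).
  rewrite -mulnA leq_mul2l; apply/orP; right.
  rewrite mulnC -sum1_size big_distrl /= big_seq [leqRHS]big_seq.
  by apply: leq_sum => s sS; rewrite mul1n tS.
have nA0 := leq_trans m0 mA.
move: wS w2 w0; move: (m * t)%N => w; set L := [seq _ | _ <- _, _ <- _] => wS w2 w0.
have sL : (size L)%:R = (size P)%:R * (size C)%:R :> F.
  by rewrite size_allpairs natrM.
rewrite -(ler_nat F) !(natrX, natrM) in wS.
rewrite -(ler_nat F) !(natrX, natrM) in w2.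
rewrite -(ler_nat F) !(natrX, natrM).
have pc0 : 0 <= (size P)%:R * (size C)%:R :> F by rewrite mulr_ge0.
set pc := _ * (size C)%:R in pc0 sL w2 |- *.
have n0 : 0 < (size A)%:R :> F by rewrite ltr0n.
have sS0 : 0 < (size S)%:R :> F by rewrite ltr0n.
have wF0 : 0 < w%:R :> F by rewrite ltr0n.
have ST := szemeredi_trotter_grid uA uS uL L0.
rewrite sL in ST; move: n0 sS0 wF0 wS w2 ST.
set n := (size A)%:R; set s := (size S)%:R; set W := w%:R.
set I := (\sum_(l <- L) _)%N%:R => n0 sS0 W0 wS w2 ST.
have q0 : 0 < 2 * s / W by rewrite divr_gt0 // mulr_gt0.
(* Chosen so that the quadratic term of the grid bound is exactly half of the lower bound [W * s]
   and can be absorbed. *)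
pose rho := n * Num.sqrt (2 * s / W).
have rho0 : 0 < rho by rewrite mulr_gt0 // sqrtr_gt0.
have rho2 : rho ^+ 2 = 2 * n ^+ 2 * s / W.
  by rewrite exprMn sqr_sqrtr 1?ltW //; ring.
clearbody rho; have := le_trans wS (ST _ rho0).
have -> : (n * s / rho) ^+ 2 = W * s / 2.
  by rewrite exprMn exprVn rho2; field; rewrite !gt_eqF.
move=> half.
have Ws : W * s <= 4 * (2 * rho + 1) * pc by lra.
have [rho1|rho1] := leP 1 rho.
  have Ws1 : W * s <= 12 * rho * pc.
    apply: le_trans Ws _; apply: ler_wpM2r => //; lra.
  have Ws2 : (W * s) ^+ 2 <= 288 * n ^+ 2 * pc ^+ 2 * s / W.
    have -> : 288 * n ^+ 2 * pc ^+ 2 * s / W = (12 * rho * pc) ^+ 2.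
      by rewrite !exprMn rho2; ring.
    apply: lerXn2r; rewrite // nnegrE; first by rewrite ltW // mulr_gt0.
    by rewrite mulr_ge0 // ltW // mulr_gt0.
  rewrite -(ler_pM2r sS0) (_ : s * W ^+ 3 * s = W * (W * s) ^+ 2); last by ring.
  rewrite (_ : 288 * (n * pc) ^+ 2 * s
               = W * (288 * n ^+ 2 * pc ^+ 2 * s / W)); last first.
    by field; rewrite gt_eqF.
  by rewrite ler_pM2l.
have Ws1 : W * s <= 12 * pc.
  apply: le_trans Ws _; apply: ler_wpM2r => //; lra.
have : W * s * W ^+ 2 <= 12 * pc * (n ^+ 2 * pc).
  by apply: ler_pM => //; rewrite ltW // ?exprn_gt0 ?mulr_gt0.
have : 0 <= n ^+ 2 * pc ^+ 2 by rewrite mulr_ge0 ?exprn_ge0 // ltW.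
rewrite (_ : W * s * W ^+ 2 = s * W ^+ 3); last by ring.
rewrite (_ : 12 * pc * (n ^+ 2 * pc) = 12 * (n ^+ 2 * pc ^+ 2)); last by ring.
rewrite (_ : 288 * (n * pc) ^+ 2 = 288 * (n ^+ 2 * pc ^+ 2)); last by ring.
lra.
Qed.

(** A layer cake inequality for cubes, from [(r + 1) ^ 3 - r ^ 3 <= 3 * (r + 1) ^ 2]; the common
    range up to [n] allows the sums to be exchanged. *)
Lemma cube_le_sum_sqr n r : (r <= n)%N ->
  (r ^ 3 <= \sum_(1 <= t < n.+1 | t <= r) 3 * t ^ 2)%N.
Proof.
move=> rn; rewrite (big_cat_nat (n := r.+1)) //= (leq_trans _ (leq_addr _ _)) //.
have -> : (\sum_(1 <= t < r.+1 | t <= r) 3 * t ^ 2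
           = \sum_(1 <= t < r.+1) 3 * t ^ 2)%N.
  rewrite big_nat_cond [RHS]big_nat_cond; apply: eq_bigl => t.
  by rewrite ltnS; case: (t <= r)%N; rewrite ?andbF ?andbT.
elim: r {rn} => [|r IH]; first by rewrite big_geq.
by rewrite big_nat_recr //=; move: IH; lia.
Qed.

(** The level sets satisfy [size (S_ t) * (m * t) ^ 3 <= 288 * M ^ 2]; with the weight [3 * t ^ 2]
    level [t] contributes at most [864 * M ^ 2 / t], a harmonic series. *)
Lemma third_moment_le (A B C P S : seq F) (m : nat) :
  uniq A -> uniq B -> uniq C -> uniq P -> uniq S ->
  0 \notin A -> {in P, forall p, p != 0} -> (size B <= size A)%N ->
  {in B, forall b, (m <= prod_rep P A b)%N} ->
  ((\sum_(s <- S) diff_rep B C s ^ 3) * m ^ 3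
    <= 864 * (trunc_log 2 (size A)).+1
         * (size A * (size P * size C)) ^ 2)%N.
Proof.
move=> uA uB uC uP uS A0 P0 BA mB; set n := size A.
set M := (n * _)%N; set H := (trunc_log 2 n).+1.
pose S_ t := [seq s <- S | (t <= diff_rep B C s)%N].
have : ((\sum_(s <- S) diff_rep B C s ^ 3) * m ^ 3
    <= \sum_(1 <= t < n.+1) size (S_ t) * (3 * t ^ 2) * m ^ 3)%N.
  rewrite -big_distrl /= leq_mul2r; apply/orP; right.
  apply: (@leq_trans (\sum_(s <- S)
      \sum_(1 <= t < n.+1 | t <= diff_rep B C s) 3 * t ^ 2))%N.
    apply: leq_sum => s _; apply: cube_le_sum_sqr.
    exact: leq_trans (diff_rep_lel B s uC) BA.
  under eq_bigr => s _ do rewrite big_mkcond /=.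
  rewrite exchange_big /=; apply: leq_sum => t _.
  rewrite -big_mkcond /= -big_filter -/(S_ t) -sum1_size big_distrl /=.
  by apply: leq_sum => s _; rewrite mul1n.
move/leq_trans; apply; rewrite -(ler_nat F) natr_sum.
rewrite (_ : (864 * H * M ^ 2 = 864 * M ^ 2 * H)%N); last by lia.
rewrite natrM; apply: sum_le_harmonic => // t _.
rewrite -natrM ler_nat.
have := @rich_diff_le A B C P (S_ t) m t uA uB uC uP (filter_uniq _ uS) A0 P0 mB.
rewrite -/n -/M => H1.
have -> : (size (S_ t) * (3 * t ^ 2) * m ^ 3 * t
           = 3 * (size (S_ t) * (m * t) ^ 3))%N by lia.
rewrite (_ : 864 = 3 * 288)%N // -mulnA leq_mul2l /= H1 //.
by move=> s; rewrite mem_filter => /andP[].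
Qed.

End RichDifferences.

(** * Energies of a set and its difference set *)

Section DifferenceSet.
Variable F : archiRcfType.

Definition differences (B C : seq F) : seq F :=
  undup [seq b - c | b <- B, c <- C].

Lemma uniq_differences (B C : seq F) : uniq (differences B C).
Proof. exact: undup_uniq. Qed.

Lemma mem_differences (B C : seq F) b c :
  b \in B -> c \in C -> b - c \in differences B C.
Proof.
by move=> bB cC; rewrite mem_undup; apply/allpairsP; exists (b, c).
Qed.

Lemma sum_diff_rep_mul (B C : seq F) (f : F -> nat) :
  (\sum_(s <- differences B C) diff_rep B C s * f s
     = \sum_(b <- B) \sum_(c <- C) f (b - c)%R)%N.
Proof.
transitivity (\sum_(b <- B) \sum_(c <- C) \sum_(s <- differences B C)
                (b - c == s)%R * f s)%N; last first.
  rewrite big_seq [RHS]big_seq; apply: eq_bigr => b bB.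
  rewrite big_seq [RHS]big_seq; apply: eq_bigr => c cC.
  by rewrite (sum_indicator_eq _ f (uniq_differences B C)) mem_differences ?mul1n.
under [RHS]eq_bigr => b _ do rewrite exchange_big /=.
rewrite [RHS]exchange_big /=; apply: eq_bigr => s _.
rewrite /diff_rep big_distrl /=; apply: eq_bigr => b _.
by rewrite big_distrl.
Qed.

Lemma sum_diff_rep (B C : seq F) :
  (\sum_(s <- differences B C) diff_rep B C s = size B * size C)%N.
Proof.
have := sum_diff_rep_mul B C (fun=> 1%N); under eq_bigr do rewrite muln1.
move=> ->; rewrite -(sum1_size B) big_distrl /=; apply: eq_bigr => b _.
by rewrite sum1_size mul1n.
Qed.

Definition triples (B : seq F) : seq (F * (F * F)) :=
  [seq (b1, b23) | b1 <- B, b23 <- [seq (b2, b3) | b2 <- B, b3 <- B]].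

Lemma sum_triples (B : seq F) (f : F * (F * F) -> nat) :
  (\sum_(t <- triples B) f t
    = \sum_(b1 <- B) \sum_(b2 <- B) \sum_(b3 <- B) f (b1, (b2, b3)))%N.
Proof.
rewrite big_allpairs; apply: eq_bigr => b1 _.
by rewrite big_allpairs.
Qed.

Definition gaps (t : F * (F * F)) : F * F := (t.2.1 - t.2.2, t.1 - t.2.1).

(* Two triples with the same consecutive differences are translates of each
   other, and the translation vector is counted by the third moment. *)
Lemma translate_triples_le (B : seq F) :
  (\sum_(t <- triples B) \sum_(t' <- triples B) (gaps t == gaps t')
     <= \sum_(s <- differences B B) diff_rep B B s ^ 3)%N.
Proof.
pose e (b b' s : F) : nat := (b - b' == s)%R.
apply: (@leq_trans (\sum_(t <- triples B) \sum_(t' <- triples B)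
  \sum_(s <- differences B B)
    e t.1 t'.1 s * (e t.2.1 t'.2.1 s * e t.2.2 t'.2.2 s)))%N.
  rewrite !sum_triples big_seq [leqRHS]big_seq; apply: leq_sum => b1 b1B.
  rewrite big_seq [leqRHS]big_seq; apply: leq_sum => b2 b2B.
  rewrite big_seq [leqRHS]big_seq; apply: leq_sum => b3 b3B.
  rewrite !sum_triples big_seq [leqRHS]big_seq; apply: leq_sum => c1 c1B.
  rewrite big_seq [leqRHS]big_seq; apply: leq_sum => c2 c2B.
  rewrite big_seq [leqRHS]big_seq; apply: leq_sum => c3 c3B.
  case: eqP => // -[e1 e2] /=.
  rewrite (sum_indicator_eq _ (fun s => e b2 c2 s * e b3 c3 s)%N
             (uniq_differences B B)) mem_differences // mul1n /e.
  (* Equal gaps force all three coordinates to be shifted by the same [b1 - c1]. *)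
  have -> : b2 - c2 = b1 - c1.
    by apply/eqP; rewrite -subr_eq0 (_ : _ - _ = - (b1 - b2) + (c1 - c2));
      [rewrite e2 addNr | ring].
  have -> : b3 - c3 = b1 - c1.
    apply/eqP; rewrite -subr_eq0.
    rewrite (_ : _ - _ = - (b2 - b3) - (b1 - b2) + ((c2 - c3) + (c1 - c2))).
      by rewrite e1 e2; apply/eqP; ring.
    by ring.
  by rewrite eqxx.
under eq_bigr => t _ do rewrite exchange_big /=.
rewrite exchange_big /=; apply: leq_sum => s _.
pose f b := (\sum_(b' <- B) e b b' s)%N.
have fE : diff_rep B B s = (\sum_(b <- B) f b)%N by [].
have -> : (\sum_(t <- triples B) \sum_(t' <- triples B)
    e t.1 t'.1 s * (e t.2.1 t'.2.1 s * e t.2.2 t'.2.2 s)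
  = \sum_(t <- triples B) f t.1 * (f t.2.1 * f t.2.2))%N.
  apply: eq_bigr => t _; rewrite sum_triples /f big_distrl /=.
  apply: eq_bigr => c1 _; rewrite big_distrl big_distrr /=.
  by apply: eq_bigr => c2 _; rewrite !big_distrr.
clearbody f; rewrite sum_triples /=.
have -> : (diff_rep B B s ^ 3 = (\sum_(b <- B) f b)
             * ((\sum_(b <- B) f b) * (\sum_(b <- B) f b)))%N by rewrite fE; lia.
rewrite [leqRHS]big_distrl /= leq_eqVlt; apply/orP; left; apply/eqP.
apply: eq_bigr => b1 _; rewrite big_distrl big_distrr /=.
by apply: eq_bigr => b2 _; rewrite !big_distrr.
Qed.

(** The threshold is half the average number of representations of a difference, written without
    division. *)
Definition popular_differences (B : seq F) : seq F :=
  [seq s <- differences B B |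
     (size B ^ 2 <= 2 * size (differences B B) * diff_rep B B s)%N].

(** Differences below half the average account for at most half of the pairs. *)
Lemma popular_pairs_le (B : seq F) :
  (size B ^ 2 <= 2 * \sum_(s <- popular_differences B) diff_rep B B s)%N.
Proof.
rewrite /popular_differences; set D := differences B B; set G := filter _ _.
have [B0|B0] := posnP (size B); first by rewrite B0.
have D0 : (0 < size D)%N.
  case EB: B B0 => [|b B'] // _.
  have : b - b \in D by apply: mem_differences; rewrite EB mem_head.
  by case: (D).
have := sum_diff_rep B B.
rewrite (bigID (fun s => size B ^ 2 <= 2 * size D * diff_rep B B s)%N) /=.
rewrite -big_filter -/D -/G.
set x := (\sum_(s <- G) _)%N; set y := (\sum_(_ <- _ | _) _)%N => e.
suff : (2 * size D * y <= size D * size B ^ 2)%N by move: e D0; nia.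
rewrite /y big_distrr /= -[X in (_ <= X * _)%N]sum1_size [leqRHS]big_distrl /=.
rewrite big_mkcond /=.
by apply: leq_sum => s _; rewrite mul1n; case: ifP => //; rewrite -ltnNge => /ltnW.
Qed.

Lemma popular_triples_le (B : seq F) : uniq B ->
  (size B * \sum_(s <- popular_differences B) diff_rep B B s
     <= size [seq t <- triples B
               | (t.2.1 - t.2.2)%R \in popular_differences B])%N.
Proof.
move=> uB; rewrite size_filter -sum_nat_count sum_triples.
rewrite -sum1_size big_distrl /=; apply: leq_sum => b1 _; rewrite mul1n.
rewrite exchange_big /=; apply: leq_sum => b2 _.
rewrite exchange_big /=; apply: leq_sum => b3 _.
by rewrite sum_indicator // filter_uniq // uniq_differences.
Qed.

(** Count collisions of [gaps] on the triples with [b2 - b3] popular, at least half of all triples.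
    Collisions are bounded by the third moment, and popularity bounds the size of the image by a
    second moment of [B - D]. *)
Lemma difference_energy_le (B : seq F) : uniq B ->
  (size B ^ 8 <= 8 * size (differences B B)
     * (\sum_(s <- differences B B) diff_rep B B s ^ 3)
     * (\sum_(x <- differences B (differences B B))
          diff_rep B (differences B B) x ^ 2))%N.
Proof.
move=> uB; set D := differences B B.
have popular := popular_pairs_le B; have le_triples := popular_triples_le uB.
move: popular le_triples; rewrite /popular_differences -/D.
set G := [seq s <- D | _] => popular le_triples.
have uD : uniq D by apply: uniq_differences.
have uG : uniq G by rewrite filter_uniq.
(* The image of [gaps] lies in [K] because [(b1 - b2) + (b2 - b3) = b1 - b3] is again a
   difference. *)
pose K := [seq su <- [seq (s, u) | s <- G, u <- D] | su.2 + su.1 \in D].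
have uK : uniq K.
  by rewrite filter_uniq // allpairs_uniq // => [] [? ?] [? ?] _ _ [-> ->].
set T := [seq t <- _ | _] in le_triples.
have hK : {in T, forall t, gaps t \in K}.
  move=> t; rewrite mem_filter => /andP[tG /allpairsP[[b1 b23] /= [b1B]]].
  move=> /allpairsP[[b2 b3] /= [b2B b3B ->]] et; move: tG; rewrite et => tG.
  rewrite mem_filter /= (_ : _ + _ = b1 - b3); last by ring.
  rewrite mem_differences //; apply/allpairsP; exists (b2 - b3, b1 - b2).
  by rewrite tG mem_differences.
have cs := sqr_size_le_collisions uK hK.
have TT : (\sum_(t <- T) \sum_(t' <- T) (gaps t == gaps t')
           <= \sum_(s <- D) diff_rep B B s ^ 3)%N.
  apply: leq_trans (translate_triples_le B).
  rewrite big_filter big_mkcond; apply: leq_sum => t _; case: ifP => // _.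
  by rewrite big_filter big_mkcond; apply: leq_sum => t' _; case: ifP.
(* Popularity of [s] lets each element of [K] be weighted by the representations [s = b1 - b2]. Then
   [u + s = v] reads [b2 - u = b1 - v], a coincidence between two representations in [B - D]. *)
have sK : (size B ^ 2 * size K
    <= 2 * size D * \sum_(x <- differences B D) diff_rep B D x ^ 2)%N.
  pose c s := (\sum_(u <- D) (u + s \in D)%R)%N.
  have -> : size K = (\sum_(s <- G) c s)%N.
    by rewrite size_filter -sum_nat_count big_allpairs.
  apply: (@leq_trans (2 * size D * \sum_(s <- D) diff_rep B B s * c s)%N).
    rewrite big_distrr big_filter big_mkcond big_distrr /=.
    by apply: leq_sum => s _; case: ifP => // le; rewrite mulnA leq_mul2r le orbT.
  rewrite leq_mul2l; apply/orP; right.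
  rewrite sum_diff_rep_mul.
  have -> : (\sum_(x <- differences B D) diff_rep B D x ^ 2
     = \sum_(b1 <- B) \sum_(v <- D) \sum_(b2 <- B) \sum_(u <- D)
         (b2 - u == b1 - v)%R)%N.
    by under eq_bigr => x _ do rewrite expnS expn1; rewrite sum_diff_rep_mul.
  apply: leq_sum => b1 _; rewrite [leqRHS]exchange_big /=.
  apply: leq_sum => b2 _; rewrite [leqRHS]exchange_big /=.
  apply: leq_sum => u _; rewrite -sum_indicator //.
  apply: leq_sum => v _; case: eqP => // e.
  rewrite (_ : b2 - u = b1 - v) ?eqxx // -e; ring.
move: cs; set E3 := (\sum_(s <- D) _)%N in TT *.
set E2 := (\sum_(x <- _) _)%N in sK *.
set TT' := (\sum_(t <- T) _)%N in TT * => cs.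
have le1 : (size B ^ 3 <= 2 * size T)%N.
  apply: leq_trans (_ : (size B * (2 * \sum_(s <- G) diff_rep B B s) <= _)%N).
    by rewrite expnS leq_mul2l popular orbT.
  by rewrite mulnCA leq_mul2l.
have le2 : (size B ^ 6 <= 4 * (size K * E3))%N.
  apply: (@leq_trans ((2 * size T) ^ 2)%N).
    by rewrite (_ : 6 = 3 * 2)%N // expnM leq_sqr.
  rewrite expnMn leq_mul2l /=; apply: leq_trans cs _.
  by rewrite leq_mul2l TT orbT.
have -> : (size B ^ 8 = size B ^ 2 * size B ^ 6)%N by rewrite -expnD.
apply: (@leq_trans (size B ^ 2 * (4 * (size K * E3)))%N).
  by rewrite leq_mul2l le2 orbT.
have -> : (size B ^ 2 * (4 * (size K * E3)) = 4 * E3 * (size B ^ 2 * size K))%N.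
  by lia.
have -> : (8 * size D * E3 * E2 = 4 * E3 * (2 * size D * E2))%N by lia.
by rewrite leq_mul2l sK orbT.
Qed.

End DifferenceSet.

(** * The expander bound *)

Local Close Scope ring_scope.

(** Squaring the first inequality produces [e2 ^ 2], which the second trades for the third moment
    [t3]; the moment bounds then use up [m ^ 9], and [b ^ 5] cancels. *)
Lemma combine_energies (a H n p b d m e2 e3 t3 : nat) :
  b ^ 8 <= 8 * d * e3 * e2 -> e2 ^ 2 <= b * d * t3 ->
  e3 * m ^ 3 <= a * H * (n * (p * b)) ^ 2 ->
  t3 * m ^ 3 <= a * H * (n * (p * d)) ^ 2 ->
  b ^ 11 * m ^ 9 <= 64 * a ^ 3 * H ^ 3 * (n * p) ^ 6 * d ^ 5.
Proof.
move=> hb h2 h3 ht; have [->|b0] := posnP b; first by rewrite exp0n.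
rewrite -(leq_pmul2l (m := b ^ 5)) ?expn_gt0 ?b0 //.
have -> : b ^ 5 * (b ^ 11 * m ^ 9) = (b ^ 8) ^ 2 * m ^ 9 by ring.
apply: (@leq_trans ((8 * d * e3 * e2) ^ 2 * m ^ 9)).
  by rewrite leq_mul2r leq_sqr hb orbT.
have -> : (8 * d * e3 * e2) ^ 2 * m ^ 9
    = 64 * d ^ 2 * (e3 * m ^ 3) ^ 2 * (e2 ^ 2 * m ^ 3) by ring.
have h23 : e2 ^ 2 * m ^ 3 <= b * d * (a * H * (n * (p * d)) ^ 2).
  apply: (@leq_trans (b * d * t3 * m ^ 3)); first by rewrite leq_mul2r h2 orbT.
  by rewrite -mulnA leq_mul2l ht orbT.
apply: (@leq_trans (64 * d ^ 2 * (a * H * (n * (p * b)) ^ 2) ^ 2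
                      * (b * d * (a * H * (n * (p * d)) ^ 2)))).
  by rewrite leq_mul // leq_mul2l leq_sqr h3 orbT.
by rewrite leq_eqVlt; apply/orP; left; apply/eqP; ring.
Qed.

Lemma combine_exponents (c1 c2 H n p k m b d x : nat) :
  0 < n -> n ^ 6 <= c1 * x ^ 2 * H ^ 2 * (p * k ^ 2) ->
  p * k <= n ^ 2 -> p * k <= H * (m * b) -> m <= n -> d <= x ->
  b ^ 11 * m ^ 9 <= c2 * H ^ 3 * (n * p) ^ 6 * d ^ 5 ->
  n ^ 26 <= c1 ^ 6 * c2 * H ^ 26 * x ^ 17.
Proof.
move=> n0 h1 pkn pkH mn dx h3.
have p0 : 0 < p.
  by case: p h1 {pkn pkH h3} => //; rewrite mul0n muln0 leqNgt expn_gt0 n0.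
(* Eleven factors [p * k] are needed to produce [b ^ 11], but only [m ^ 9] is available; in the two
   others [m] is replaced by [n]. *)
have pk2 : (p * k) ^ 2 <= (H * (n * b)) ^ 2.
  by rewrite leq_sqr (leq_trans pkH) // leq_mul2l leq_mul2r mn !orbT.
have pk9 : (p * k) ^ 9 <= (H * (m * b)) ^ 9 by rewrite leq_exp2r.
have pk11 : (p * k) ^ 11 <= c2 * H ^ 14 * n ^ 8 * p ^ 6 * d ^ 5.
  have -> : (p * k) ^ 11 = (p * k) ^ 2 * (p * k) ^ 9 by rewrite -expnD.
  apply: leq_trans (leq_mul pk2 pk9) _.
  have -> : (H * (n * b)) ^ 2 * (H * (m * b)) ^ 9
      = H ^ 11 * n ^ 2 * (b ^ 11 * m ^ 9) by ring.
  have -> : c2 * H ^ 14 * n ^ 8 * p ^ 6 * d ^ 5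
      = H ^ 11 * n ^ 2 * (c2 * H ^ 3 * (n * p) ^ 6 * d ^ 5) by ring.
  by rewrite leq_mul2l h3 orbT.
(* One more factor [p * k <= n ^ 2] and division by [p ^ 6] leave [(p * k ^ 2) ^ 6], the quantity in
   the sixth power of the lower bound. *)
have pk12 : p ^ 6 * k ^ 12 <= c2 * H ^ 14 * n ^ 10 * d ^ 5.
  rewrite -(leq_pmul2l (m := p ^ 6)) ?expn_gt0 ?p0 //.
  have -> : p ^ 6 * (p ^ 6 * k ^ 12) = p * k * (p * k) ^ 11 by ring.
  apply: leq_trans (leq_mul pkn pk11) _.
  by rewrite leq_eqVlt; apply/orP; left; apply/eqP; ring.
rewrite -(leq_pmul2l (m := n ^ 10)) ?expn_gt0 ?n0 //.
have -> : n ^ 10 * n ^ 26 = (n ^ 6) ^ 6 by rewrite -expnD -expnM.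
apply: (@leq_trans ((c1 * x ^ 2 * H ^ 2 * (p * k ^ 2)) ^ 6)).
  by rewrite leq_exp2r.
have -> : (c1 * x ^ 2 * H ^ 2 * (p * k ^ 2)) ^ 6
    = c1 ^ 6 * x ^ 12 * H ^ 12 * (p ^ 6 * k ^ 12) by ring.
apply: (@leq_trans (c1 ^ 6 * x ^ 12 * H ^ 12 * (c2 * H ^ 14 * n ^ 10 * x ^ 5))).
  rewrite leq_mul2l (leq_trans pk12) ?orbT // leq_mul2l leq_exp2r // dx.
  by rewrite orbT.
by rewrite leq_eqVlt; apply/orP; left; apply/eqP; ring.
Qed.

Local Open Scope ring_scope.

Lemma few_products_many_differences (F : archiRcfType) (A B P : seq F) (m : nat) :
  uniq A -> uniq B -> uniq P -> 0 \notin A -> {in P, forall p, p != 0} ->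
  (size B <= size A)%N -> {in B, forall b, (m <= prod_rep P A b)%N} ->
  (size B ^ 11 * m ^ 9 <= 64 * 864 ^ 3 * (trunc_log 2 (size A)).+1 ^ 3
     * (size A * size P) ^ 6 * size (differences B B) ^ 5)%N.
Proof.
move=> uA uB uP A0 P0 BA mB; set D := differences B B.
have uD : uniq D := uniq_differences B B.
pose e2 := (\sum_(x <- differences B D) diff_rep B D x ^ 2)%N.
pose e3 := (\sum_(s <- D) diff_rep B B s ^ 3)%N.
pose t3 := (\sum_(x <- differences B D) diff_rep B D x ^ 3)%N.
apply: (@combine_energies 864 _ _ _ _ _ _ e2 e3 t3).
- exact: difference_energy_le.
(* The second moment is interpolated between the first, equal to [size B * size D], and the
   third. *)
- have := cauchy_schwarz_nat (differences B D) (diff_rep B D) (fun=> 1%N)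
            (diff_rep B D).
  under eq_bigr do rewrite mul1n mulnn.
  under [X in (_ <= X * _)%N -> _]eq_bigr do rewrite exp1n muln1.
  rewrite sum_diff_rep; move/leq_trans; apply.
  by rewrite leq_mul2l; apply/orP; right; apply: leq_sum => x _; rewrite -expnS.
- exact: third_moment_le.
exact: third_moment_le (uniq_differences B D) A0 P0 BA mB.
Qed.

Lemma expander_bound : exists C : nat, forall (F : archiRcfType) (A Z : seq F),
  uniq A -> 0 \notin A -> (0 < size A)%N -> uniq Z ->
  {in A, forall a, {in A, forall b, {in A, forall c, a * (b - c) \in Z}}} ->
  (size A ^ 26 <= C * (trunc_log 2 (size A)).+1 ^ 26 * size Z ^ 17)%N.
Proof.
exists (36 ^ 6 * (64 * 864 ^ 3))%N => F A Z uA A0 sA0 uZ hZ.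
have [k [P [uP P0 rP Pk h1]]] := popular_ratios uA A0 sA0 uZ hZ.
have rn : {in A, forall a, (prod_rep P A a <= size A)%N}.
  by move=> a _; apply: prod_rep_le.
have [m /andP[m0 mn] hm] := popular_level sA0 rn.
pose B := [seq a <- A | (m <= prod_rep P A a)%N].
have uB : uniq B by rewrite filter_uniq.
have BA : (size B <= size A)%N by rewrite size_filter count_size.
have mB : {in B, forall b, (m <= prod_rep P A b)%N}.
  by move=> b; rewrite mem_filter => /andP[].
apply: (combine_exponents sA0 h1 Pk _ mn); last first.
- exact: (few_products_many_differences uA uB uP A0 P0 BA mB).
(* A dilate of [B - B] by a nonzero element of [A] lies in [Z], so
   [size (differences B B) <= size Z]. *)
- case EA: A sA0 => [//|a0 A'] _.
  have a0A : a0 \in A by rewrite EA mem_head.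
  have a00 : a0 != 0 by apply: contraTneq a0A => ->.
  rewrite -(size_map ( *%R a0)); apply: uniq_leq_size.
    by rewrite map_inj_uniq ?uniq_differences //; apply: mulfI.
  move=> y /mapP[d]; rewrite mem_undup => /allpairsP[[b c] /= []].
  by rewrite !mem_filter => /andP[_ bA] /andP[_ cA] -> ->; apply: hZ.
(* Each [p] in [P] is a ratio [a / q] in at least [k] ways, and each of these is a representation
   [p q = a]; hence [size P * k] is at most the total of [prod_rep] over [A]. *)
rewrite -size_filter -/B in hm; apply: leq_trans hm.
rewrite /prod_rep exchange_big /= -sum1_size big_distrl /=.
rewrite big_seq [leqRHS]big_seq; apply: leq_sum => p pP; rewrite mul1n.
by rewrite exchange_big; apply: rP.
Qed.

Local Close Scope ring_scope.

(* Specialization to the real numbers and to logarithms *)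
Require Import Defs.
From mathcomp Require Import Rstruct.

Open Scope R_scope.

Lemma mem_prod_diff_set (A : seq R) (a b c : R) :
  a \in A -> b \in A -> c \in A -> a * (b - c) \in prod_diff_set A.
Proof.
move=> aA bA cA; rewrite mem_undup; apply/flattenP.
exists [seq a * (bc.1 - bc.2) | bc <- [seq (b, c) | b <- A, c <- A]].
  by apply/mapP; exists a.
by apply/mapP; exists (b, c) => //; apply/allpairsP; exists (b, c).
Qed.

(** For a nonzero [a] in [A] the map [b |-> a * (b - a)] is injective. This lets the logarithm of
    [size A] be replaced by that of [size (prod_diff_set A)]. *)
Lemma size_le_prod_diff_set (A : seq R) :
  uniq A -> (2 <= size A)%N -> (size A <= size (prod_diff_set A))%N.
Proof.
move=> uA sA.
have [a aA a0] : exists2 a, a \in A & a != 0.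
  case: A uA sA => [|x [|y A]] //= /andP[xA _] _.
  have [x0|x0] := eqVneq x 0; last by exists x; rewrite ?mem_head.
  exists y; first by rewrite !inE eqxx orbT.
  by apply: contraNneq xA => y0; rewrite x0 y0 mem_head.
rewrite -(size_map (fun b => a * (b - a))); apply: uniq_leq_size.
  rewrite map_inj_uniq // => b c /(Rmult_eq_reg_l _ _ _) h.
  by have := h (elimN eqP a0); Lra.lra.
by move=> _ /mapP[b bA ->]; apply: mem_prod_diff_set.
Qed.

(** Discarding 0 removes at most one element, so the size at most halves; this costs the factor
    [2 ^ 26]. *)
Lemma prod_diff_set_bound : exists C : nat, forall A : seq R,
  uniq A -> (2 <= size A)%N ->
  (size A ^ 26 <= C * (trunc_log 2 (size A)).+1 ^ 26
                    * size (prod_diff_set A) ^ 17)%N.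
Proof.
have [C hC] := expander_bound; exists (2 ^ 26 * C)%N => A uA sA.
have := fun a => expnMn 2 a 26; move: (2 ^ 26)%N => pow26 pow_double.
pose A' := [seq a <- A | a != 0].
have uA' : uniq A' by rewrite filter_uniq.
have sA' : (size A <= (size A').+1)%N.
  rewrite /A' size_filter -(count_predC (fun a => a != 0) A) -addn1 leq_add2l.
  by apply: count_le1 => // x y _ _ /=; rewrite !negbK => /eqP -> /eqP ->.
have A'A : (size A' <= size A)%N by rewrite size_filter count_size.
have s0 : (0 < size A')%N by rewrite -ltnS; apply: leq_trans sA'.
have A'0 : (0%R : R) \notin A' by rewrite mem_filter eqxx.
have hZ : {in A', forall a, {in A', forall b, {in A', forall c,
    GRing.mul a (GRing.add b (GRing.opp c)) \in prod_diff_set A}}}.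
  move=> a; rewrite mem_filter => /andP[_ aA] b.
  rewrite mem_filter => /andP[_ bA] c; rewrite mem_filter => /andP[_ cA].
  exact: mem_prod_diff_set.
have := hC _ A' _ uA' A'0 s0 (undup_uniq _) hZ.
rewrite -/(prod_diff_set A) => le.
apply: (@leq_trans ((2 * size A') ^ 26)).
  rewrite leq_exp2r // mul2n -addnn; apply: leq_trans sA' _.
  by rewrite -addn1 leq_add2l.
rewrite pow_double -(mulnA pow26 C) -(mulnA pow26) leq_mul2l; apply/orP; right.
apply: leq_trans le _; rewrite leq_mul2r; apply/orP; right.
rewrite leq_mul2l; apply/orP; right.
by rewrite leq_exp2r // ltnS leq_trunc_log.
Qed.

Lemma ln_le (x y : R) : 0 < x -> x <= y -> ln x <= ln y.
Proof.
move=> x0 [xy|->]; last exact: Rle_refl.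
by apply: Rlt_le; apply: ln_increasing.
Qed.

Lemma trunc_log2_le (n x : nat) : (0 < n <= x)%N ->
  INR (trunc_log 2 n) <= log2 (INR x).
Proof.
move=> /andP[n0 nx].
have ln2 : 0 < ln 2 by rewrite -ln_1; apply: ln_increasing; Lra.lra.
have le : (2 ^ trunc_log 2 n <= x)%N by apply: leq_trans nx; apply: trunc_logP.
have : INR (2 ^ trunc_log 2 n) <= INR x by apply/le_INR/ssrnat.leP.
have -> : INR (2 ^ trunc_log 2 n) = 2 ^ trunc_log 2 n.
  elim: (trunc_log 2 n) => [|j IH] //.
  by rewrite expnS mult_INR IH.
move=> h; rewrite /log2; apply: (Rmult_le_reg_r (ln 2)) => //.
rewrite /Rdiv Rmult_assoc Rinv_l ?Rmult_1_r; last Lra.lra.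
rewrite -ln_pow; last Lra.lra.
apply: ln_le => //; apply: pow_lt; Lra.lra.
Qed.

Theorem theorem1p3 :
  exists K c : R, 0 < K /\ 0 < c /\
    forall A : seq R, uniq A -> (2 <= size A)%nat ->
      Rpower (INR (size A)) (3 / 2 + 1 / 34) <=
        K * INR (size (prod_diff_set A)) *
          Rpower (log2 (INR (size (prod_diff_set A)))) c.
Proof.
have [C hC] := prod_diff_set_bound.
(* The successor makes the constant positive, and [2 ^ 26] absorbs the estimate
   [trunc_log 2 n + 1 <= 2 * L], valid because [L >= 1]. *)
pose C' := INR C.+1 * 2 ^ 26.
have C'0 : 0 < C'.
  apply: Rmult_lt_0_compat; first by apply/lt_0_INR/ssrnat.ltP.
  by apply: pow_lt; Lra.lra.
exists (Rpower C' (1 / 17)), (26 / 17); split; first exact: exp_pos.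
split; first Lra.lra.
move=> A uA sA; have nX := size_le_prod_diff_set uA sA.
have := hC A uA sA; move: nX sA; move: (size A) (size (prod_diff_set A)).
move=> n x nx n2 bound.
have n0 : (0 < n)%N by apply: leq_trans n2.
have n0R : 0 < INR n by apply/lt_0_INR/ssrnat.ltP.
have x2 : 2 <= INR x.
  by apply: (le_INR 2); apply/ssrnat.leP; apply: leq_trans nx.
have ln2 : 0 < ln 2 by rewrite -ln_1; apply: ln_increasing; Lra.lra.
have L1 : 1 <= log2 (INR x).
  rewrite /log2; apply: (Rmult_le_reg_r (ln 2)) => //.
  rewrite /Rdiv Rmult_assoc Rinv_l; last Lra.lra.
  rewrite Rmult_1_l Rmult_1_r; apply: ln_le; Lra.lra.
have H2 : INR (trunc_log 2 n).+1 <= 2 * log2 (INR x).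
  have := @trunc_log2_le n x; rewrite n0 nx => /(_ isT).
  rewrite S_INR; Lra.lra.
set L := log2 (INR x) in L1 H2 *.
have powE m j : INR (m ^ j) = INR m ^ j.
  by elim: j => [|j IH] //; rewrite expnS mult_INR IH.
have main : INR n ^ 26 <= C' * L ^ 26 * INR x ^ 17.
  have : INR (n ^ 26) <= INR (C * (trunc_log 2 n).+1 ^ 26 * x ^ 17).
    by apply/le_INR/ssrnat.leP.
  rewrite (mult_INR (C * _ ^ 26) (x ^ 17)) (mult_INR C) !powE => h; apply: Rle_trans h _.
  apply: Rmult_le_compat_r; first by apply: pow_le; Lra.lra.
  rewrite /C' Rmult_assoc -Rpow_mult_distr.
  apply: Rmult_le_compat; try exact: pos_INR.
  - by apply: pow_le; apply: pos_INR.
  - by apply/le_INR/ssrnat.leP.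
  - by apply: pow_incr; split=> //; apply: pos_INR.
(* Taking 17th roots of [n ^ 26 <= C' * L ^ 26 * x ^ 17] gives the exponent 26/17 both for [n] and
   for the logarithm. *)
have root : Rpower (INR n ^ 26) (1 / 17)
    <= Rpower (C' * L ^ 26 * INR x ^ 17) (1 / 17).
  by apply: Rle_Rpower_l; [Lra.lra | split=> //; apply: pow_lt].
have L26 : 0 < L ^ 26 by apply: pow_lt; Lra.lra.
have x17 : 0 < INR x ^ 17 by apply: pow_lt; Lra.lra.
have rootX (y : R) j : 0 < y -> Rpower (y ^ j) (1 / 17) = Rpower y (INR j / 17).
  move=> y0; rewrite -Rpower_pow // Rpower_mult; by rewrite /Rdiv Rmult_1_l.
have Cl0 : 0 < C' * L ^ 26 by apply: Rmult_lt_0_compat.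
move: root; rewrite -(Rpower_mult_distr (C' * L ^ 26)) //.
rewrite -(Rpower_mult_distr C') // !rootX //; try Lra.lra.
have -> : INR 26 / 17 = 26 / 17 by rewrite /=; Lra.lra.
have -> : INR 17 / 17 = 1 by rewrite /=; Lra.lra.
rewrite Rpower_1; last Lra.lra.
have -> : 3 / 2 + 1 / 34 = 26 / 17 by Lra.lra.
by move=> h; rewrite Rmult_assoc (Rmult_comm (INR x)) -Rmult_assoc.
Qed.
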